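(* Let $T$ be a subset of $\mathbb Z_+\times\mathbb Z_+$ such that $(n,m)\in T$ for all $(m,n)\in T$, and $(n,n)\in T$ for all $n\in\mathbb Z_+$. Then the set $\Sigma_T^2(\mathbb C)$ is dense in $\mathscr P_T^+(\mathbb C)$ with respect to the finest locally convex topology on $\mathbb C_T[z,\bar z]$. In particular, this is the case for the topology of uniform convergence on compact subsets of $\mathbb C$ and the topology given by the norm $\|\cdot\|_{\mathrm{co}}$.
   Context: $\mathbb Z_+=\{0,1,2,\dots\}$. For $T\subset\mathbb Z_+\times\mathbb Z_+$, $\mathbb C_T[z,\bar z]$ is the linear space of all complex polynomials in $z,\bar z$ of the form $\sum_{(m,n)\in T}a_{m,n}z^m\bar z^n$ (finitely many nonzero coefficients), regarded as functions on $\mathbb C$. $\mathscr P_T^+(\mathbb C)$ is the set of all $q\in\mathbb C_T[z,\bar z]$ with $q(z,\bar z)\ge0$ for all $z\in\mathbb C$. $\mathbb C_{\mathfrak N_+}(z,\bar z)$ is the set of all functions on $\mathbb C\setminus\{0\}$ of the form $z\mapsto\sum_{m,n\in\mathbb Z,\ m+n\ge0}a_{m,n}z^m\bar z^n$ with finitely many nonzero coefficients $a_{m,n}\in\mathbb C$. $\Sigma_T^2(\mathbb C)$ is the set of all $q\in\mathbb C_T[z,\bar z]$ for which there exist finitely many $q_1,\dots,q_k\in\mathbb C_{\mathfrak N_+}(z,\bar z)$ with $q(z,\bar z)=\sum_{j=1}^k|q_j(z,\bar z)|^2$ for all $z\in\mathbb C\setminus\{0\}$. For a polynomial $p(z,\bar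 z)=\sum_{m,n\ge0}a_{m,n}z^m\bar z^n$, $\|p\|_{\mathrm{co}}=\max\{|a_{m,n}|\colon m,n\ge0\}$. The finest locally convex topology on a linear space $V$ is the one given by the family of all seminorms on $V$. *)

(* Defs.v *)
From HB Require Import structures.
From mathcomp Require Import all_boot all_order all_algebra.
From mathcomp Require Import finmap monalg complex.
From mathcomp Require Import all_classical all_reals all_analysis.
From mathcomp Require Import ring lra zify.

Set Implicit Arguments.
Unset Strict Implicit.
Unset Printing Implicit Defensive.

Import Order.TTheory GRing.Theory Num.Theory.
Import numFieldNormedType.Exports.

Local Open Scope classical_set_scope.
Local Open Scope complex_scope.
Local Open Scope ring_scope.

(* The complex numbers are R[i] for an arbitrary R : realType; 0 <= w in R[i]
   means that w is real and nonnegative, and R[i]^o carries the usual topology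
   of the complex plane. *)

(* C_T[z, zbar] is the free R[i]-module on the index set T: the element p has
   coefficient p@_t at z^m zbar^n for t = (m, n).  peval_inj below shows that
   p is determined by the function that it induces on the plane. *)
Notation CPoly R T := {malg R[i][set_type (T : set (nat * nat))]}.

Definition peval {R : realType} {T : set (nat * nat)} (p : CPoly R T)
    (z : R[i]) : R[i] :=
  mmap idfun (fun t : T => z ^+ (\val t).1 * (z^*) ^+ (\val t).2) p.

Definition Nplus : set (int * int) := [set mn | 0 <= mn.1 + mn.2].

(* Only the values at z != 0 are meaningful (0 ^ (-1) is 0 in the library). *)
Definition leval {R : realType} (f : {malg R[i][Nplus]}) (z : R[i]) : R[i] :=
  mmap idfun (fun t : Nplus => z ^ (\val t).1 * (z^*) ^ (\val t).2) f.

Definition nonneg_poly (R : realType) (T : set (nat * nat)) : set (CPoly R T) :=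
  [set q | forall z, 0 <= peval q z].

Definition sos_poly (R : realType) (T : set (nat * nat)) : set (CPoly R T) :=
  [set q | exists s : seq {malg R[i][Nplus]},
     forall z, z != 0 -> peval q z = \sum_(f <- s) `|leval f z| ^+ 2].

Definition seminorm (R : realType) (V : lmodType R[i]) (N : V -> R) : Prop :=
  (forall x y, N (x + y) <= N x + N y) /\
  (forall (a : R[i]) x, N (a *: x) = ComplexField.Normc.normc a * N x).

(* The space V with the topology given by the family F of seminorms: the open
   semiballs of the members of F form a subbase. *)
Definition seminorm_topology (R : realType) (V : lmodType R[i])
  (F : set (V -> R)) : Type := V.

HB.instance Definition _ (R : realType) (V : lmodType R[i])
    (F : set (V -> R)) := Choice.on (seminorm_topology F).
HB.instance Definition _ (R : realType) (V : lmodType R[i])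
    (F : set (V -> R)) :=
  @isSubBaseTopological.Build (seminorm_topology F) (set V)
    [set B | exists N : V -> R, exists x : V, exists e : R,
      [/\ F N, 0 < e & B = [set y | N (y - x) < e]]] id.

Definition finest_lc (R : realType) (V : lmodType R[i]) : topologicalType :=
  seminorm_topology (@seminorm R V).

Definition compact_conv (R : realType) (T : set (nat * nat)) :
    topologicalType :=
  initial_topology
    (peval : CPoly R T -> {family compact, R[i]^o -> R[i]^o}).

Definition co_norm (R : realType) (T : set (nat * nat)) (p : CPoly R T) : R :=
  \big[Order.max/0]_(t <- msupp p) ComplexField.Normc.normc p@_t.

Definition co_topology (R : realType) (T : set (nat * nat)) :
    topologicalType :=
  seminorm_topology [set @co_norm R T].

Definition dense_in (X : topologicalType) (A B : set X) : Prop :=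
  A `<=` B /\ B `<=` closure A.

Section injectivity.
Variable C : numClosedFieldType.

Let poly_eq0 (Q : {poly C}) (f : nat -> C) :
  injective f -> (forall k, Q.[f k] = 0) -> Q = 0.
Proof.
move=> finj Qf; apply/eqP/negPn/negP => Q0.
have := @max_poly_roots _ Q [seq f k | k <- iota 0 (size Q)] Q0.
rewrite size_map size_iota ltnn map_inj_uniq ?iota_uniq // => H.
by suff /H -/(_ isT) : all (root Q) [seq f k | k <- iota 0 (size Q)] by [];
  apply/allP => _ /mapP[k _ ->]; apply/rootP.
Qed.

Let unitc (k : nat) : C := (1 + 'i * k%:R) / (1 - 'i * k%:R).

Let conj_num (k : nat) : (1 + 'i * k%:R)^* = 1 - 'i * k%:R :> C.
Proof. by rewrite rmorphD rmorph1 rmorphM /= conjCi conjC_nat mulNr. Qed.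

Let num_neq0 (k : nat) : 1 + 'i * k%:R != 0 :> C.
Proof.
apply/eqP => /(congr1 (fun x => x * x^*)); rewrite conj_num mul0r => /eqP.
rewrite (_ : _ * _ = 1 - 'i ^+ 2 * k%:R ^+ 2); last by ring.
by rewrite sqrCi mulN1r opprK -natrX nat1r pnatr_eq0.
Qed.

Let denom_neq0 (k : nat) : 1 - 'i * k%:R != 0 :> C.
Proof. by rewrite -conj_num conjC_eq0. Qed.

Let unitcJ k : unitc k * (unitc k)^* = 1.
Proof.
have -> : (unitc k)^* = (1 - 'i * k%:R) / (1 + 'i * k%:R).
  by rewrite /unitc rmorphM fmorphV /= -conj_num conjCK.
by rewrite /unitc mulrACA -invfM [X in _ / X]mulrC divff // mulf_neq0.
Qed.

Let unitc_inj : injective unitc.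
Proof.
move=> j k /eqP; rewrite eqr_div // -subr_eq0.
rewrite (_ : _ - _ = 2 * 'i * (j%:R - k%:R)); last by ring.
by rewrite !mulf_eq0 pnatr_eq0 (negPf (neq0Ci C)) /= subr_eq0 eqr_nat => /eqP.
Qed.

Lemma monomials_free (I : eqType) (s : seq I) (e : I -> nat * nat)
    (a : I -> C) : injective e -> uniq s ->
  (forall z, \sum_(t <- s) a t * (z ^+ (e t).1 * z^* ^+ (e t).2) = 0) ->
  forall t, t \in s -> a t = 0.
Proof.
move=> e_inj s_uniq a0 t0 t0s.
pose M := (\sum_(t <- s) (e t).2)%N.
have leM t : t \in s -> ((e t).2 <= M)%N.
  by move=> ts; rewrite /M (big_rem t) //= leq_addr.
pose d t := ((e t).1 + (M - (e t).2))%N.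
pose c t z := a t * (z ^+ (e t).1 * z^* ^+ (e t).2).
have Q1 z : \sum_(t <- s) c t z *: 'X^(d t) = 0 :> {poly C}.
  apply: (poly_eq0 unitc_inj) => k; rewrite horner_sum.
  transitivity (unitc k ^+ M * (\sum_(t <- s) c t (z * unitc k))).
    rewrite mulr_sumr !big_seq; apply: eq_bigr => t ts.
    rewrite hornerZ hornerXn /c /d rmorphM /=.
    move: (unitc k) (unitcJ k) => w ww; rewrite !exprMn exprD.
    have -> : w ^+ M = w ^+ (M - (e t).2) * w ^+ (e t).2.
      by rewrite -exprD subnK // leM.
    have : w ^+ (e t).2 * w^* ^+ (e t).2 = 1 by rewrite -exprMn ww expr1n.
    move: (w ^+ (e t).2) (w^* ^+ (e t).2) => u v uv.
    by rewrite -[LHS]mulr1 -uv; ring.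
  by rewrite /c a0 mulr0.
have Q2 : \sum_(t <- s | d t == d t0)
    a t *: 'X^((e t).1 + (e t).2) = 0 :> {poly C}.
  apply: (@poly_eq0 _ (fun k : nat => k%:R)) => [j k /eqP|k].
    by rewrite eqr_nat => /eqP.
  have /(congr1 (fun Q : {poly C} => Q`_(d t0))) := Q1 k%:R.
  rewrite coef0 coef_sum horner_sum => E; rewrite -[RHS]E [LHS]big_mkcond.
  apply: eq_bigr => t _; rewrite coefZ coefXn eq_sym /c conjC_nat -exprD.
  by case: eqP => _; rewrite /= ?mulr0 // mulr1 hornerZ hornerXn.
have /(congr1 (fun Q : {poly C} => Q`_((e t0).1 + (e t0).2))) := Q2.
rewrite coef0 coef_sum -big_filter (bigD1_seq t0) ?filter_uniq ?mem_filter ?eqxx //=.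
rewrite coefZ coefXn eqxx mulr1.
rewrite big_seq_cond big1 ?addr0 // => t; rewrite mem_filter.
move=> /andP[/andP[/eqP dt ts] tt0].
rewrite coefZ coefXn; case: eqP => [et|]; last by rewrite mulr0.
case/negP: tt0; apply/eqP/e_inj; move: dt et (leM _ ts) (leM _ t0s).
rewrite /d; case: (e t) (e t0) => [m n] [m0 n0] /= *.
by congr pair; lia.
Qed.

End injectivity.

Lemma peval_inj (R : realType) (T : set (nat * nat)) : injective (@peval R T).
Proof.
suff key p : (forall z, @peval R T p z = 0) -> p = 0.
  move=> p q pq; apply/eqP; rewrite -subr_eq0; apply/eqP/key => z.
  by rewrite /peval raddfB /= -/(peval p z) -/(peval q z) pq subrr.
move=> p0; apply/malgP => t; rewrite mcoeff0; case: (msuppP p t) => // tp.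
exact: (monomials_free val_inj (fset_uniq _) p0 tp).
Qed.

(* Main.v *)
(* Let q >= 0 on the plane and r = 1 + |z|^(2M) with M large.  It suffices that
   Q = q + e r is a sum of squares for every e > 0, since Q tends to q along
   the line q + R r as e tends to 0.  Write z = x v with x real and |v| = 1, so
   that Q is a trigonometric polynomial in v with coefficients in R[x].  The
   Fejer kernel F_n multiplies the l-th Fourier coefficient by 1 - |l| / n, so
   Q is the average over the N-th roots of unity u of g_u(x) F_n(v / u), where
   g_u(x) is obtained from Q(x u) by dividing the l-th coefficient by
   1 - |l| / n.  For n large g_u differs from Q(x u) by less than e r, hence is
   positive on the real line and is there the squared modulus of a polynomial;
   F_n is a squared modulus as well.  This expresses Q as a sum of squares of
   polynomials in x and v.  As (x, v) and (-x, -v) stand for the same z, such a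
   square may be replaced by those of its even and odd parts; the even part,
   and v times the odd part, are combinations of x^i v^k with i = k mod 2, i.e.
   of z^m zbar^n with m + n = i >= 0. *)

Require Import Defs.
From HB Require Import structures.
From mathcomp Require Import all_boot all_order all_algebra.
From mathcomp Require Import cyclic separable cyclotomic.
From mathcomp Require Import finmap monalg complex.
From mathcomp Require Import all_classical all_reals all_analysis.
From mathcomp Require Import ring lra zify.

Set Implicit Arguments.
Unset Strict Implicit.
Unset Printing Implicit Defensive.

Import Order.TTheory GRing.Theory Num.Theory.
Import numFieldNormedType.Exports.
Import ComplexField.Normc.

Local Open Scope classical_set_scope.
Local Open Scope complex_scope.
Local Open Scope ring_scope.

(** * Positive polynomials on the line and on the circle *)

(** In characteristic 0 the polynomial X^n - 1 is separable, so it has n distinct roots, and n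
    distinct n-th roots of unity include a primitive one. *)
Lemma closed_prim_root_exists (C : numClosedFieldType) (n : nat) :
  (0 < n)%N -> exists w : C, n.-primitive_root w.
Proof.
move=> n_gt0; pose p : {poly C} := 'X^n - 1.
have [r Dp] := closed_field_poly_normal p.
move: Dp; rewrite (monicP _) ?monicXnsubC // scale1r => Dp.
have rn1 : all n.-unity_root r by apply/allP=> z; rewrite -root_prod_XsubC -Dp.
have sz_r : (n < (size r).+1)%N.
  by rewrite -(size_prod_XsubC r id) -Dp size_XnsubC.
have [|z] := hasP (has_prim_root n_gt0 rn1 _ sz_r); last by exists z.
by rewrite -separable_prod_XsubC -Dp separable_Xn_sub_1 // pnatr_eq0 -lt0n.
Qed.

Lemma poly_eq0_nat (F : numDomainType) (p : {poly F}) :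
  (forall k : nat, p.[k%:R] = 0) -> p = 0.
Proof.
move=> pk; apply/eqP/negPn/negP => p0.
have := @max_poly_roots _ p [seq k%:R | k <- iota 0 (size p)] p0.
rewrite size_map size_iota ltnn map_inj_uniq ?iota_uniq; last first.
  by move=> i j /eqP; rewrite eqr_nat => /eqP.
move=> H; suff /H/(_ isT) :
  all (root p) [seq k%:R | k <- iota 0 (size p)] by [].
by apply/allP => _ /mapP[k _ ->]; apply/rootP.
Qed.

(* A polynomial that is positive on the real line has no real root, and its
   roots come in conjugate pairs. *)
Lemma gt0_poly_normsq (C : numClosedFieldType) (p : {poly C}) :
  (forall t, t \is Num.real -> 0 < p.[t]) ->
  exists h : {poly C}, forall t, t \is Num.real -> p.[t] = `|h.[t]| ^+ 2.
Proof.
have [n] := ubnP (size p); elim: n => // n IHn in p *.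
rewrite ltnS => szp p_gt0.
have p0 : p != 0.
  by apply: contraTneq (p_gt0 0 (real0 _)) => ->; rewrite horner0 ltxx.
have [/closed_rootP[x px]|] := boolP (size p != 1); last first.
  rewrite negbK => /eqP sz1; exists (sqrtC p`_0)%:P => t _.
  rewrite -normrX [in LHS](size1_polyC (eq_leq sz1)) !hornerC sqrtCK.
  have /p_gt0 := real0 C; rewrite (size1_polyC (eq_leq sz1)) hornerC => /ltW.
  by rewrite coefC eqxx => /ger0_norm.
have xNreal : x \isn't Num.real.
  by apply: contraTN px => /p_gt0 H; rewrite /root gt_eqF.
(* [p] agrees with its conjugate at the naturals, where its values are real. *)
have pJ : map_poly Num.conj p = p.
  apply/eqP; rewrite -subr_eq0; apply/eqP/poly_eq0_nat => k.
  have kr : k%:R \is @Num.real C by exact: realn.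
  rewrite hornerD hornerN -{1}(conj_Creal kr) horner_map /=.
  by rewrite conj_Creal ?subrr // gtr0_real // p_gt0.
have pxJ : root p x^* by rewrite -pJ /root horner_map (rootP px) rmorph0.
have [p1 Dp] := factor_theorem p x px.
have : root p1 x^*.
  have := pxJ; rewrite Dp rootM => /orP[//|].
  by rewrite root_XsubC => /eqP /CrealP; rewrite (negPf xNreal).
move=> /factor_theorem[p2 Dp1].
have p2t t : t \is Num.real -> p.[t] = p2.[t] * `|t - x| ^+ 2.
  move=> tr; rewrite Dp Dp1 !hornerM !hornerXsubC normCK rmorphB /=.
  by rewrite (conj_Creal tr) -mulrA [X in _ * X]mulrC.
have tx t : t \is Num.real -> 0 < `|t - x| ^+ 2.
  move=> tr; rewrite exprn_gt0 // normr_gt0 subr_eq0.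
  by apply: contraNneq xNreal => <-.
have p20 : p2 != 0.
  by apply: contraNneq p0; rewrite Dp Dp1 => ->; rewrite !mul0r.
have sz : (size p2 < n)%N.
  have szM (q : {poly C}) y : q != 0 -> size (q * ('X - y%:P)) = (size q).+1.
    by move=> q0; rewrite size_Mmonic ?monicXsubC // size_XsubC addn2.
  apply: leq_trans szp; rewrite Dp Dp1 !szM //.
  by rewrite mulf_neq0 ?polyXsubC_eq0.
have [t tr|h Dh] := IHn p2 sz.
  by have := p_gt0 t tr; rewrite p2t // pmulr_lgt0 // tx.
exists (h * ('X - x%:P)) => t tr.
by rewrite p2t // Dh // hornerM hornerXsubC normrM exprMn.
Qed.

(** On the real line ['Re p.[t]] is itself the value of a polynomial, the mean of [p] and its
    conjugate. *)
Lemma Re_gt0_poly_normsq (C : numClosedFieldType) (p : {poly C}) :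
  (forall t, t \is Num.real -> 0 < 'Re p.[t]) ->
  exists h : {poly C}, forall t, t \is Num.real -> 'Re p.[t] = `|h.[t]| ^+ 2.
Proof.
move=> p_gt0; pose q := 2^-1 *: (p + map_poly Num.conj p).
have qE t : t \is Num.real -> q.[t] = 'Re p.[t].
  move=> tr; rewrite hornerZ hornerD -{2}(conj_Creal tr) horner_map.
  by rewrite /= ReE mulrC.
have [t tr|h hE] := @gt0_poly_normsq _ q; first by rewrite qE // p_gt0.
by exists h => t tr; rewrite -qE // hE.
Qed.

(** * Fejer averaging over the roots of unity *)

Section Fejer.
Variable C : numClosedFieldType.

Lemma prim_root_norm (N : nat) (w : C) : N.-primitive_root w -> `|w| = 1.
Proof.
move=> wN; have N0 := prim_order_gt0 wN.
apply/eqP; rewrite -(@pexpr_eq1 _ _ N) // -normrX prim_expr_order //.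
by rewrite normr1.
Qed.

Lemma mulCJ_norm1 (w : C) : `|w| = 1 -> w * w^* = 1.
Proof. by move=> w1; rewrite -normCK w1 expr1n. Qed.

(** A geometric sum of ratio w^(a - b); since a, b < N, the ratio is 1 only if a = b. *)
Lemma sum_prim_root (N : nat) (w : C) (a b : nat) :
  N.-primitive_root w -> (a < N)%N -> (b < N)%N ->
  \sum_(j < N) ((w ^+ j) ^+ a * (w ^+ j)^* ^+ b) = N%:R *+ (a == b).
Proof.
move=> wN aN bN; pose x := w ^+ a * w^* ^+ b.
have ww := mulCJ_norm1 (prim_root_norm wN).
transitivity (\sum_(j < N) x ^+ j).
  by apply: eq_bigr => j _; rewrite rmorphXn /= exprMn (exprAC w) (exprAC w^*).
have [ab|ab] := eqVneq a b.
  have -> : x = 1 by rewrite /x ab -exprMn ww expr1n.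
  by under eq_bigr do rewrite expr1n; rewrite sumr_const card_ord.
have xN : x ^+ N = 1.
  have wJN : w^* ^+ N = 1 by rewrite -rmorphXn /= prim_expr_order // rmorph1.
  rewrite exprMn -!exprM (mulnC a) (mulnC b) !exprM wJN (prim_expr_order wN).
  by rewrite !expr1n mulr1.
have x1 : x - 1 != 0.
  rewrite subr_eq0; apply: contra ab => /eqP /(congr1 ( *%R^~ (w ^+ b))).
  rewrite mul1r /x -mulrA -exprMn [_ * w]mulrC ww expr1n mulr1 => /eqP.
  by rewrite (eq_prim_root_expr wN) !modn_small.
apply: (mulfI x1); rewrite -subrX1 xN subrr mulr0n mulr0 //.
Qed.

(* The product of [n] with the Fejer weight 1 - |a - b| / n. *)
Definition fejer_count (n a b : nat) : nat :=
  \sum_(k < n) \sum_(l < n) (a + l == b + k)%N.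

(** For each k at most one l satisfies a + l = b + k. *)
Lemma fejer_count_le n a b : (fejer_count n a b <= n)%N.
Proof.
rewrite -[X in (_ <= X)%N]card_ord -sum1_card; apply: leq_sum => k _.
have [l0 /eqP Dl0|nol] := pickP (fun l : 'I_n => a + l == b + k)%N.
  rewrite (bigD1 l0) //= big1 ?addn0 ?leq_b1 // => l ll0.
  rewrite -Dl0 eqn_add2l; apply/eqP; rewrite eqb0; exact: ll0.
by rewrite big1 // => l _; rewrite nol.
Qed.

(** Every k with a <= k < n - b has a partner l = b + k - a below n. *)
Lemma fejer_count_ge n a b : (n - (a + b) <= fejer_count n a b)%N.
Proof.
rewrite /fejer_count.
pose f k := (\sum_(l < n) (a + l == b + k))%N.
rewrite -(big_mkord xpredT f) /=.
have [nab|abn] := leqP n (a + b).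
  by move: nab; rewrite -subn_eq0 => /eqP ->.
rewrite (@big_cat_nat _ _ _ a) //=; last by lia.
rewrite (@big_cat_nat _ _ _ (n - b) a) //=; [|lia|lia].
rewrite addnCA; apply: leq_trans (leq_addr _ _).
have -> : (n - (a + b) = \sum_(a <= k < n - b) 1)%N.
  by rewrite sum_nat_const_nat; lia.
rewrite big_nat_cond [X in (_ <= X)%N]big_nat_cond.
apply: leq_sum => k /andP[/andP[ak kn] _].
have ln : (b + k - a < n)%N by lia.
rewrite /f (bigD1 (Ordinal ln)) //= (_ : (a + (b + k - a) == b + k)%N) //.
by lia.
Qed.

(** After expanding the square, the sum over u = w^j keeps the terms v^k vbar^l with a + l = b + k,
    and each of them equals v^a vbar^b. The bounds by N keep the exponents of u and ubar below N, as
    orthogonality requires. *)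
Lemma fejer_identity (N n a b : nat) (w v : C) :
  N.-primitive_root w -> (a + n <= N)%N -> (b + n <= N)%N -> `|v| = 1 ->
  \sum_(j < N) ((w ^+ j) ^+ a * (w ^+ j)^* ^+ b *
     `|\sum_(k < n) (v * (w ^+ j)^* ) ^+ k| ^+ 2) =
  (N * fejer_count n a b)%:R * (v ^+ a * v^* ^+ b).
Proof.
move=> wN aN bN v1; have vv := mulCJ_norm1 v1.
transitivity (\sum_(k < n) \sum_(l < n) (v ^+ k * v^* ^+ l *
   \sum_(j < N) ((w ^+ j) ^+ (a + l) * (w ^+ j)^* ^+ (b + k)))).
  under [RHS]eq_bigr do under eq_bigr do rewrite mulr_sumr.
  under [RHS]eq_bigr do rewrite exchange_big.
  rewrite [RHS]exchange_big /=; apply: eq_bigr => j _.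
  rewrite normCK rmorph_sum /= mulr_suml mulr_sumr; apply: eq_bigr => k _.
  rewrite !mulr_sumr; apply: eq_bigr => l _.
  move: (w ^+ j) => u; rewrite rmorphXn rmorphM /= conjCK !exprMn !exprD; ring.
rewrite natrM natr_sum mulr_sumr mulr_suml; apply: eq_bigr => k _.
rewrite natr_sum mulr_sumr mulr_suml; apply: eq_bigr => l _.
have kn := ltn_ord k; have ln := ltn_ord l.
rewrite (sum_prim_root wN) //; [|lia|lia].
have [E|_] := eqVneq; last by rewrite mulr0n !mulr0 mul0r.
rewrite mulr1n mulr1 mulrC; congr (_ * _).
transitivity (v ^+ (b + k) * v^* ^+ (l + b)).
  rewrite -[LHS]mulr1 -(expr1n _ b) -vv exprMn !exprD; ring.
rewrite -E -[RHS]mulr1 -(expr1n _ l) -vv exprMn !exprD; ring.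
Qed.

Lemma expr_le1D (x : C) (k m : nat) :
  0 <= x -> (k <= m)%N -> x ^+ k <= 1 + x ^+ m.
Proof.
move=> x0 km; have [x1|x1] := real_leP (ger0_real x0) (real1 C).
  by rewrite -[X in X <= _]addr0 lerD ?exprn_ge0 // exprn_ile1.
by rewrite -[X in X <= _]add0r lerD // ler_eXn2l.
Qed.

(** Dividing by a Fejer weight c / n with n - M <= c <= n changes a coefficient by the relative
    amount (n - c) / c <= M / (n - M). The last hypothesis makes the total error smaller than d (1 +
    |x|^M), the lower bound of [Q]. *)
Lemma trig_poly_sum_normsq (I : eqType) (s : seq I) (e : I -> nat * nat)
    (a : I -> C) (M n : nat) (d : C) :
  let Q z := \sum_(t <- s) a t * (z ^+ (e t).1 * z^* ^+ (e t).2) in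
  {in s, forall t, ((e t).1 + (e t).2 <= M)%N} ->
  (forall z, d * (1 + `|z| ^+ M) <= Q z) ->
  (M < n)%N -> (\sum_(t <- s) `|a t|) * M%:R < d * (n - M)%:R ->
  exists f : seq ({poly C} * C), forall x v : C, x \is Num.real -> `|v| = 1 ->
  Q (x * v) = \sum_(hu <- f) `|hu.1.[x] * \sum_(k < n) (v * hu.2) ^+ k| ^+ 2.
Proof.
move=> Q eM Qd Mn dn.
have n0 : (0 < n)%N by apply: leq_trans Mn.
pose N := (M + n)%N; have N0 : (0 < N)%N by rewrite addn_gt0 n0 orbT.
have [w wN] := closed_prim_root_exists C N0.
pose c t := fejer_count n (e t).1 (e t).2.
have cge t : t \in s -> (n - M <= c t)%N.
  move=> /eM etM; apply: leq_trans (fejer_count_ge _ _ _); exact: leq_sub2l.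
have c_neq0 t : t \in s -> (c t)%:R != 0 :> C.
  by move=> /cge; rewrite pnatr_eq0; lia.
pose g j : {poly C} := \sum_(t <- s) (a t * (n%:R / (c t)%:R) *
  ((w ^+ j) ^+ (e t).1 * (w ^+ j)^* ^+ (e t).2)) *: 'X^((e t).1 + (e t).2).
have gE j x : (g j).[x] = \sum_(t <- s) a t * (n%:R / (c t)%:R) *
    ((w ^+ j) ^+ (e t).1 * (w ^+ j)^* ^+ (e t).2) * x ^+ ((e t).1 + (e t).2).
  by rewrite horner_sum; apply: eq_bigr => t _; rewrite hornerZ hornerXn.
have w1 j : `|w ^+ j| = 1 by rewrite normrX (prim_root_norm wN) expr1n.
have monoE (x v : C) (k l : nat) : x \is Num.real ->
    (x * v) ^+ k * (x * v)^* ^+ l = v ^+ k * v^* ^+ l * x ^+ (k + l).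
  by move=> xr; rewrite rmorphM /= (conj_Creal xr) !exprMn exprD; ring.
(* The bound on [n] forces d > 0, and whatever is comparable with a real number is real. *)
have Qr z : Q z \is Num.real.
  have dr : d \is Num.real.
    have S0 : 0 <= (\sum_(t <- s) `|a t|) * M%:R.
      by rewrite mulr_ge0 ?sumr_ge0.
    have := le_lt_trans S0 dn; rewrite pmulr_lgt0 ?ltr0n ?subn_gt0 //.
    exact: gtr0_real.
  have /ger_real -> := Qd z.
  by rewrite realM // ger0_real // addr_ge0 // exprn_ge0.
have Re_gt0 j x : x \is Num.real -> 0 < 'Re (g j).[x].
  move=> xr; pose E := (g j).[x] - Q (x * w ^+ j).
  have -> : (g j).[x] = Q (x * w ^+ j) + E by rewrite /E addrC subrK.
  rewrite raddfD /= (Creal_ReP _ (Qr _)).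
  have E_lt : `|E| < d * (1 + `|x| ^+ M).
    have EE : E = \sum_(t <- s) a t * (((n - c t)%N%:R / (c t)%:R) *
        ((w ^+ j) ^+ (e t).1 * (w ^+ j)^* ^+ (e t).2) *
        x ^+ ((e t).1 + (e t).2)).
      rewrite /E gE /Q -sumrB !big_seq; apply: eq_bigr => u us.
      rewrite monoE // natrB ?fejer_count_le //.
      by field; exact: c_neq0.
    have nM0 : 0 < (n - M)%N%:R :> C by rewrite ltr0n subn_gt0.
    rewrite -(ltr_pM2l nM0).
    apply: (@le_lt_trans _ _ ((\sum_(t <- s) `|a t|) * M%:R * (1 + `|x| ^+ M))).
      rewrite EE; apply: le_trans (ler_wpM2l (ltW nM0) (ler_norm_sum _ _ _)) _.
      rewrite mulr_sumr !mulr_suml !big_seq; apply: ler_sum => u us.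
      rewrite !normrM !normrX norm_conjC !normrX (prim_root_norm wN) !expr1n.
      rewrite !mulr1 normfV !normr_nat -[leRHS]mulrA.
      set X := `|x| ^+ (_ + _); set c' := _^-1; set m := (n - c u)%:R.
      have -> : (n - M)%:R * (`|a u| * (m * c' * X)) =
          `|a u| * ((n - M)%:R * m * c' * X) by ring.
      rewrite ler_wpM2l // /X /c' /m.
      rewrite ler_pM ?mulr_ge0 ?exprn_ge0 ?invr_ge0 //; last first.
        by rewrite expr_le1D // eM.
      have := cge u us; have := c_neq0 u us; rewrite pnatr_eq0 => c0 cn.
      rewrite ler_pdivrMr ?ltr0n ?lt0n // -!natrM ler_nat mulnC leq_mul //.
      by lia.
    by rewrite [ltRHS]mulrCA [ltRHS]mulrA ltr_pM2r.
  have := Qd (x * w ^+ j); rewrite normrM w1 mulr1 => /(lt_le_trans E_lt) EQ.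
  have : `|'Re E| <= `|E| := leif_normC_Re_Creal E.
  rewrite real_ler_norml ?Creal_Re // => /andP[ReE _].
  by rewrite -ltrBlDl sub0r; apply: lt_le_trans ReE; rewrite ltrN2.
(* Passing to the real part spares a proof that the coefficients of [g j], which
   are real by uniqueness of the coefficients of [Q], are real. *)
have /choice[h hE] := fun j => Re_gt0_poly_normsq (Re_gt0 j).
(* The averaging yields a factor N c, which the quotient n / c in [g] turns into N n. *)
pose r := sqrtC ((N * n)%:R : C).
have r0 : r != 0 by rewrite sqrtC_eq0 pnatr_eq0 -lt0n muln_gt0 N0.
exists [seq (r^-1 *: h j, (w ^+ j)^* ) | j : 'I_N] => x v xr v1.
rewrite big_map big_enum /=.
apply: (mulfI (expf_neq0 2 r0)).
rewrite -[in LHS](Creal_ReP _ (Qr _)) sqrtCK.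
transitivity (\sum_(j < N)
    'Re (g j).[x] * `|\sum_(k < n) (v * (w ^+ j)^* ) ^+ k| ^+ 2).
  have RM (y z : C) : 'Re y * `|z| ^+ 2 = 'Re (`|z| ^+ 2 * y).
    by rewrite ReMl ?rpredX ?normr_real // mulrC.
  under eq_bigr do rewrite RM.
  rewrite -raddf_sum -ReMl ?realn //; congr ('Re _).
  under [RHS]eq_bigr do rewrite gE mulr_sumr.
  rewrite exchange_big /= /Q mulr_sumr !big_seq; apply: eq_bigr => t ts.
  rewrite monoE //.
  have := eM t ts => leM.
  transitivity (a t * (n%:R / (c t)%:R) * x ^+ ((e t).1 + (e t).2) *
        ((N * c t)%:R * (v ^+ (e t).1 * v^* ^+ (e t).2))).
    by rewrite !natrM; field; exact: c_neq0.
  rewrite -(fejer_identity wN) ?mulr_sumr //; [|rewrite /N; lia..].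
  by apply: eq_bigr => j _; ring.
rewrite mulr_sumr; apply: eq_bigr => j _.
rewrite hE // hornerZ -mulrA normrM exprMn normfV exprVn -exprMn -normrM.
have -> : `|r| = r by rewrite ger0_norm // sqrtC_ge0.
by rewrite -[(N * n)%:R]sqrtCK -/r mulVKf ?expf_neq0.
Qed.

End Fejer.

(** * Squares of Laurent polynomials *)

Lemma big_map_cat (V : nmodType) (I J : Type) (s : seq I) (f g : I -> J)
    (F : J -> V) :
  \sum_(j <- map f s ++ map g s) F j = \sum_(i <- s) (F (f i) + F (g i)).
Proof. by rewrite big_cat !big_map big_split. Qed.

Section Parity.
Variable C : numClosedFieldType.

Definition parity_part (n : nat) (h : {poly C}) (u : C) (b : bool) (x v : C) :=
  \sum_(i < size h) \sum_(k < n | odd (i + k) == b)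
    h`_i * u ^+ k * (x ^+ i * v ^+ k).

Lemma parity_partN n h u b x v :
  parity_part n h u b (- x) (- v) = (-1) ^+ b * parity_part n h u b x v.
Proof.
rewrite /parity_part mulr_sumr; apply: eq_bigr => i _.
rewrite mulr_sumr; apply: eq_bigr => k /eqP <-.
by rewrite signr_odd exprD (exprNn x) (exprNn v); ring.
Qed.

Lemma sum_parity_part n (h : {poly C}) u x v :
  h.[x] * \sum_(k < n) (v * u) ^+ k =
  parity_part n h u false x v + parity_part n h u true x v.
Proof.
rewrite horner_coef mulr_suml -big_split /=; apply: eq_bigr => i _.
rewrite mulr_sumr (bigID (fun k : 'I_n => odd (i + k) == false)) /=.
congr (_ + _).
  by apply: eq_bigr => k _; rewrite exprMn; ring.
by apply: eq_big => [k|k _]; [case: odd|rewrite exprMn; ring].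
Qed.

Lemma parallelogram (x y : C) :
  `|x + y| ^+ 2 + `|x - y| ^+ 2 = 2 * (`|x| ^+ 2 + `|y| ^+ 2).
Proof. by rewrite !normCK !rmorphD /= rmorphN; ring. Qed.

(** The two products are the sum and, by parity, the difference of the even and odd parts, so the
    parallelogram law applies. *)
Lemma parity_part_normsq n (h : {poly C}) u x v :
  `|h.[x] * \sum_(k < n) (v * u) ^+ k| ^+ 2 +
  `|h.[- x] * \sum_(k < n) (- v * u) ^+ k| ^+ 2 =
  2 * (`|parity_part n h u false x v| ^+ 2 +
       `|parity_part n h u true x v| ^+ 2).
Proof.
rewrite -parallelogram !sum_parity_part !parity_partN.
by rewrite expr0 expr1 mul1r mulN1r.
Qed.

End Parity.

Section Laurent.
Variable R : realType.

Lemma Nplus_subproof (i p : nat) : (Posz p, Posz i - Posz p) \in Nplus.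
Proof. by rewrite inE /Nplus /= subrKC. Qed.

(** The monomial z^p zbar^(i - p) of total degree i; its second exponent may be negative. *)
Definition Nplus_mono (i p : nat) : Nplus := SigSub (Nplus_subproof i p).

(** As vbar = 1 / v on the unit circle, the monomial is x^i v^(2p - i). *)
Lemma Nplus_monoE (x v : R[i]) (i p k : nat) : x \is Num.real -> x != 0 ->
  `|v| = 1 -> (p.*2 = i + k)%N ->
  (x * v) ^ (val (Nplus_mono i p)).1 * (x * v)^* ^ (val (Nplus_mono i p)).2 =
  x ^+ i * v ^+ k.
Proof.
move=> xr x0 v1 pik; have vv := mulCJ_norm1 v1.
have v0 : v != 0 by rewrite -normr_gt0 v1.
have vJ0 : v^* != 0 by rewrite conjC_eq0.
rewrite rmorphM /= (conj_Creal xr) expfzDr ?mulf_neq0 // -exprnN -!exprnP.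
rewrite !exprMn.
have vJ : v^* = v^-1 by apply: (mulfI v0); rewrite vv divff.
have vk : v ^+ k = v ^+ p * v ^+ p / v ^+ i.
  by apply: (canRL (mulfK _)); rewrite ?expf_neq0 // -!exprD addnn pik addnC.
rewrite vk vJ !exprVn; field.
by rewrite !expf_neq0.
Qed.

(* Multiplying the odd part ([b = true]) by v makes every x^i v^(k + b) satisfy
   i = k + b mod 2, hence equal to z^m zbar^(i - m) with m = (i + k + b) / 2. *)
Definition parity_laurent (n : nat) (h : {poly R[i]}) (u : R[i]) (b : bool) :
    {malg R[i][Nplus]} :=
  \sum_(i < size h) \sum_(k < n | odd (i + k) == b)
    << h`_i * u ^+ k *g Nplus_mono i (i + k + b)./2 >>.

Lemma leval_parity n h (u : R[i]) b x v :
  x \is Num.real -> x != 0 -> `|v| = 1 ->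
  leval (parity_laurent n h u b) (x * v) = v ^+ b * parity_part n h u b x v.
Proof.
move=> xr x0 v1; rewrite /leval raddf_sum mulr_sumr; apply: eq_bigr => i _.
rewrite raddf_sum mulr_sumr; apply: eq_bigr => k /eqP ob.
rewrite /= mmapU (@Nplus_monoE x v i _ (k + b)) //; last first.
  by rewrite addnA -[RHS]odd_double_half oddD ob oddb addbb.
by rewrite exprD /=; ring.
Qed.

(** The representation is used at (|z|, z / |z|) and at (-|z|, -z / |z|), which give the same z; the
    sum of the two is twice the sum of the squares of the even and odd parts. *)
Lemma sos_poly_gt (T : set (nat * nat)) (p : CPoly R T) (M : nat) (d : R) :
  0 < d -> {in msupp p, forall t, ((val t).1 + (val t).2 <= M)%N} ->
  (forall z, d%:C * (1 + `|z| ^+ M) <= peval p z) -> sos_poly p.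
Proof.
move=> d0 pM pd.
pose S : R[i] := \sum_(t <- msupp p) `|p@_t|.
have Sr : S \is Num.real by rewrite ger0_real // sumr_ge0.
(* Chosen so that n - M exceeds S M / d. *)
pose n := (M + (Num.truncn (complex.Re S * M%:R / d)).+1)%N.
have nS : S * M%:R < d%:C * (n - M)%N%:R.
  rewrite addKn -[X in X * _](RRe_real Sr) -!(rmorph_nat (real_complex R)).
  by rewrite -!rmorphM ltcR -ltr_pdivrMl // mulrC truncnS_gt.
have Mn : (M < n)%N by rewrite /n; lia.
have [f fE] := trig_poly_sum_normsq pM pd Mn nS.
exists ([seq parity_laurent n hu.1 hu.2 false | hu <- f] ++
        [seq parity_laurent n hu.1 hu.2 true | hu <- f]) => z z0.
pose v : R[i] := z / `|z|.
have nz0 : `|z| != 0 by rewrite normr_eq0.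
have v1 : `|v| = 1 by rewrite normrM normfV normr_id divff.
have zE : z = `|z| * v by rewrite mulrC divfK.
have zr : `|z| \is Num.real by exact: normr_real.
have lE b h u : `|leval (parity_laurent n h u b) z| ^+ 2 =
    `|parity_part n h u b `|z| v| ^+ 2.
  by rewrite [in LHS]zE leval_parity // normrM normrX v1 expr1n mul1r.
have fz : peval p z = \sum_(hu <- f)
    `|hu.1.[`|z|] * \sum_(k < n) (v * hu.2) ^+ k| ^+ 2.
  by have := fE _ _ zr v1; rewrite -zE.
have fNz : peval p z = \sum_(hu <- f)
    `|hu.1.[- `|z|] * \sum_(k < n) (- v * hu.2) ^+ k| ^+ 2.
  have Nzr : - `|z| \is Num.real by rewrite rpredN.
  have Nv1 : `|- v| = 1 by rewrite normrN.
  by have := fE _ _ Nzr Nv1; rewrite mulrNN -zE.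
rewrite big_map_cat; apply: (@mulfI R[i] 2); first by rewrite pnatr_eq0.
have := congr2 +%R fz fNz; rewrite -mulr2n => E.
rewrite [LHS]mulr_natl [LHS]E -big_split mulr_sumr; apply: eq_bigr => hu _.
apply: (etrans (parity_part_normsq n hu.1 hu.2 `|z| v)).
by rewrite -(lE false) -(lE true).
Qed.

End Laurent.

(** * Topologies on the space of polynomials *)

Section Complex.
Variable R : realType.

Lemma norm_normc (z : R[i]) : `|z| = (normc z)%:C.
Proof. by []. Qed.

Lemma normc_ge0 (z : R[i]) : 0 <= normc z.
Proof. by case: z => a b; exact: sqrtr_ge0. Qed.

Lemma normc_real (x : R) : 0 <= x -> normc x%:C = x.
Proof.
by move=> x0; apply/complexI; rewrite -norm_normc ger0_norm // lecR.
Qed.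

Lemma normc_ge_ReIm (a b : R) :
  `|a| <= normc (a +i* b) /\ `|b| <= normc (a +i* b).
Proof.
by split; rewrite -sqrtr_sqr ler_wsqrtr // ?lerDl ?lerDr sqr_ge0.
Qed.

Lemma seminorm_co_norm (T : set (nat * nat)) : seminorm (@co_norm R T).
Proof.
have coef_le (p : CPoly R T) t : normc p@_t <= co_norm p.
  have [tp|tp] := msuppP p t; last first.
    by rewrite normc0 /co_norm bigmax_idl le_max lexx.
  exact: (@le_bigmax_seq _ _ _ _ _ t xpredT (fun t => normc p@_t) tp).
have le_co (p : CPoly R T) c :
    0 <= c -> (forall t, normc p@_t <= c) -> co_norm p <= c.
  by move=> c0 pc; apply: bigmax_le.
have co_ge0 (p : CPoly R T) : 0 <= co_norm p.
  by rewrite /co_norm bigmax_idl le_max lexx.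
split=> [p q|a p].
  apply: le_co => [|t]; first by rewrite addr_ge0.
  by rewrite mcoeffD (le_trans (le_normcD _ _)) // lerD.
(* Applied to a^-1 and [a *: p], this also gives the reverse inequality. *)
have le_scale b (g : CPoly R T) : co_norm (b *: g) <= normc b * co_norm g.
  apply: le_co => [|t]; first by rewrite mulr_ge0 ?normc_ge0.
  by rewrite mcoeffZ normcM ler_wpM2l ?normc_ge0.
apply/eqP; rewrite eq_le le_scale /=.
have [->|a0] := eqVneq a 0.
  by rewrite scale0r normc0 mul0r co_ge0.
have na0 : 0 < normc a.
  rewrite lt_neqAle normc_ge0 andbT eq_sym.
  by apply: contra a0 => /eqP/eq0_normc ->.
by rewrite -ler_pdivlMl // -normcV -{1}(scalerK a0 p).
Qed.

Lemma near_infty_lt (a b : R) :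
  0 < b -> \forall n \near \oo, n.+1%:R^-1 * a < b.
Proof.
move=> b0; exists (Num.truncn (a / b)) => // n /= le_n.
rewrite ltr_pdivrMl // -ltr_pdivrMr //.
by apply: lt_le_trans (truncnS_gt _) _; rewrite ler_nat ltnS.
Qed.

(** A basic neighbourhood of q is a finite intersection of semiballs, not necessarily centred at q.
    In each, the margin e - N (q - x) eventually exceeds N r / (n + 1). *)
Lemma cvg_seminorm_topology (V : lmodType R[i]) (F : set (V -> R)) (q r : V) :
  F `<=` @seminorm R V ->
  (fun n => q + (n.+1%:R^-1)%:C *: r : seminorm_topology F) @ \oo -->
    (q : seminorm_topology F).
Proof.
move=> Fs A [X [[B sB <-] [W BW Wx] BV]].
have [G GD GW] := sB _ BW.
apply: (@filterS _ \oo _ (fun n => W (q + (n.+1%:R^-1)%:C *: r))).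
  by move=> n Wn; apply: BV; exists W.
rewrite -GW; apply: filter_bigI => /= S SG.
have := GD _ SG; rewrite inE => -[N [x [e [FN e0 SE]]]].
have qS : S q by move: Wx; rewrite -GW; apply.
have [ND NZ] := Fs _ FN.
rewrite SE in qS *.
have d0 : 0 < e - N (q - x) by rewrite subr_gt0.
apply: filterS (near_infty_lt (N r) d0) => n; rewrite ltrBrDr => lt_e.
apply: le_lt_trans lt_e; rewrite addrAC (le_trans (ND _ _)) //.
by rewrite [leLHS]addrC lerD2r NZ normc_real ?invr_ge0.
Qed.

(** The open discs of integer radius about 0 cover the set; the sum of the radii of a finite
    subcover bounds each of them. *)
Lemma compact_bounded_complex (A : set R[i]^o) : compact A ->
  exists K : nat, forall z, A z -> normc z <= K%:R.
Proof.
rewrite compact_cover => Aco.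
have [||D _ DA] :=
  Aco _ [set: nat] (fun n => [set z : R[i]^o | normc z < n%:R]).
- move=> n _; rewrite openE => p /= pn.
  apply/nbhs_ballP; exists (n%:R - normc p)%:C => [|q].
    by rewrite /= ltcR subr_gt0.
  rewrite -ball_normE /ball_ /= [X in X < _]norm_normc ltcR ltrBrDr.
  move=> /(le_lt_trans _); apply.
  by rewrite -(normcN (p - q)) -[X in normc X <= _](subrK p) opprB le_normcD.
- by move=> z _; exists (Num.truncn (normc z)).+1 => //=; exact: truncnS_gt.
exists (\sum_(n <- D) n)%N => z /DA[n Dn /ltW /le_trans]; apply.
by rewrite ler_nat (big_rem n) //= leq_addr.
Qed.

Variable T : set (nat * nat).

Lemma peval_norm_le (p : CPoly R T) (z : R[i]) (K : R) : normc z <= K ->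
  `|peval p z| <=
    (\sum_(t <- msupp p) normc p@_t * K ^+ ((val t).1 + (val t).2))%:C.
Proof.
move=> zK; rewrite /peval mmapE raddf_sum.
apply: le_trans (ler_norm_sum _ _ _) _; apply: ler_sum => t _ /=.
rewrite !normrM !normrX norm_conjC -exprD norm_normc -rmorphXn -rmorphM lecR.
rewrite ler_wpM2l ?normc_ge0 // lerXn2r ?nnegrE ?normc_ge0 //.
by rewrite (le_trans _ zK) ?normc_ge0.
Qed.

Lemma pevalDZ (p q : CPoly R T) c z :
  peval (p + c *: q) z = peval p z + c * peval q z.
Proof.
rewrite /peval mmapD (mmapEw (msuppZ_le c q)) mmapE mulr_sumr; congr (_ + _).
by apply: eq_bigr => t _; rewrite /= mcoeffZ [RHS]mulrA.
Qed.

(** On a compact set the difference from q is r / (n + 1), and r is bounded there. *)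
Lemma cvg_compact_conv (q r : CPoly R T) :
  (fun n => q + (n.+1%:R^-1)%:C *: r : compact_conv R T) @ \oo -->
    (q : compact_conv R T).
Proof.
move=> A [_ [[B oB <-] Bq] BA]; apply: filterS BA _.
suff : {family compact,
    (fun n => peval (q + (n.+1%:R^-1)%:C *: r) : R[i]^o -> R[i]^o) @ \oo -->
    (peval q : R[i]^o -> R[i]^o)}.
  apply; exact: open_nbhs_nbhs.
apply/fam_cvgP => K /compact_bounded_complex[k kK].
move=> P /uniform_nbhs[E [entE EP]].
apply: filterS EP _.
move: entE; rewrite -entourage_ballE => -[e /= e0 sE].
have er : e = (complex.Re e)%:C by rewrite RRe_real ?gtr0_real.
move: e0; rewrite er ltcR => e0.
pose B' := \sum_(t <- msupp r) normc r@_t * k%:R ^+ ((val t).1 + (val t).2).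
apply: filterS (near_infty_lt B' e0) => n lt_e z Kz.
apply: sE => /=; rewrite -ball_normE /ball_ /= er pevalDZ opprD addNKr normrN.
rewrite normrM norm_normc normc_real ?invr_ge0 //.
apply: (@le_lt_trans _ _ ((n.+1%:R^-1)%:C * B'%:C)).
  apply: ler_wpM2l; last exact: (peval_norm_le r (kK z Kz)).
  by rewrite lecR invr_ge0.
by rewrite -rmorphM ltcR.
Qed.

(** The constant terms cancel, and every other monomial has modulus at most x on (0, 1]. *)
Lemma peval_near0 (p : CPoly R T) (x : R) : 0 < x -> x <= 1 ->
  `|peval p x%:C - peval p 0| <= (x * \sum_(t <- msupp p) normc p@_t)%:C.
Proof.
move=> x0 x1; have xr : x%:C \is Num.real by rewrite complex_real.
rewrite /peval !mmapE -sumrB mulr_sumr raddf_sum.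
apply: le_trans (ler_norm_sum _ _ _) _; apply: ler_sum => t _ /=.
rewrite -mulrBr normrM mulrC rmorphM ler_wpM2r //.
rewrite (conj_Creal xr) conjC0 -!exprD.
case: (_ + _)%N => [|k]; first by rewrite !expr0 subrr normr0 lecR ltW.
have x0' : 0 <= x%:C by rewrite lecR ltW.
rewrite expr0n subr0 (ger0_norm (exprn_ge0 _ x0')) -rmorphXn lecR.
by have x0r := ltW x0; rewrite exprS ler_piMr ?exprn_ile1.
Qed.

Lemma le0_of_le_mul (y B : R) :
  0 <= B -> (forall x, 0 < x -> x <= 1 -> y <= x * B) -> y <= 0.
Proof.
move=> B0 H; rewrite leNgt; apply/negP => y0.
have yB : 0 < y + B + 1 by rewrite addr_gt0 // ltr_wpDr.
(* This x lies in (0, 1) and satisfies x B < y. *)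
have := H (y / (y + B + 1)) (divr_gt0 y0 yB).
rewrite ler_pdivrMr // mul1r -addrA ler_wpDr // ?addr_ge0 // => /(_ isT).
rewrite mulrAC ler_pdivlMr // addrA; nra.
Qed.

(** A representation as a sum of squares says nothing at z = 0; there nonnegativity follows by
    continuity along the positive real axis. *)
Lemma sos_poly_nonneg : @sos_poly R T `<=` @nonneg_poly R T.
Proof.
move=> q [s qs].
have q_ge0 z : z != 0 -> 0 <= peval q z.
  by move=> z0; rewrite qs // sumr_ge0 // => f _; rewrite exprn_ge0.
move=> z; have [->|/q_ge0 //] := eqVneq z 0.
pose B := \sum_(t <- msupp q) normc q@_t.
have B0 : 0 <= B by apply: sumr_ge0 => t _; exact: normc_ge0.
case E0 : (peval q 0) => [a b].
(* With c = q(x) >= 0, both |b| and c - a are at most |q(x) - q(0)|, and -a <= c - a. *)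
have near0 x : 0 < x -> x <= 1 -> `|b| <= x * B /\ - a <= x * B.
  move=> x0 x1; have := peval_near0 q x0 x1.
  have /q_ge0 px : x%:C != 0 by rewrite gt_eqF // ltcR.
  have /complex_realP[c Ec] := ger0_real px; rewrite Ec E0 norm_normc lecR.
  move: px; rewrite Ec lecR => c0 /=.
  have [H1 H2] := normc_ge_ReIm (c - a) (0 - b).
  move=> H; rewrite -normrN -sub0r; split; first exact: le_trans H2 _.
  apply: le_trans H; apply: le_trans H1; apply: le_trans (ler_norm _).
  by rewrite lerDr.
rewrite lecE /= -normr_le0; apply/andP; split.
  by apply: (le0_of_le_mul B0) => x x0 x1; have [] := near0 x x0 x1.
rewrite -oppr_le0; apply: (le0_of_le_mul B0) => x x0 x1.
by have [] := near0 x x0 x1.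
Qed.

(** One [r] serves every [e], so that q is approached along a line, on which all seminorms
    converge. *)
Lemma nonneg_poly_approx (q : CPoly R T) :
  (forall n, T (n, n)) -> nonneg_poly q ->
  exists r : CPoly R T, forall e : R, 0 < e -> sos_poly (q + e%:C *: r).
Proof.
move=> Tdiag q_ge0.
(* The sum of the total degrees bounds each of them. *)
pose M := (\sum_(t <- msupp q) ((val t).1 + (val t).2))%N.
pose diag n : T := SigSub (mem_set (Tdiag n)).
pose r : CPoly R T := << diag 0%N >> + << diag M >>.
have rE z : peval r z = 1 + `|z| ^+ (M + M).
  rewrite /peval mmapD !mmapU /= !expr0 !mul1r -exprMn -normCK -exprM.
  by rewrite mul2n addnn.
exists r => e e0; apply: (@sos_poly_gt R T _ (M + M) e e0) => [t|z]; last first.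
  by rewrite pevalDZ rE lerDr q_ge0.
move=> /(fsubsetP (msuppD_le _ _)); rewrite in_fsetU => /orP[tq|].
  rewrite /M (big_rem t tq) /=; lia.
move=> /(fsubsetP (msuppZ_le _ _))/(fsubsetP (msuppD_le _ _)); rewrite in_fsetU.
by move=> /orP[]/(fsubsetP msuppU_le); rewrite in_fset1 => /eqP ->.
Qed.

End Complex.

Theorem proposition36 (R : realType) (T : set (nat * nat))
    (Tsym : forall m n : nat, T (m, n) -> T (n, m))
    (Tdiag : forall n : nat, T (n, n)) :
  [/\ @dense_in (finest_lc (CPoly R T)) (@sos_poly R T) (@nonneg_poly R T),
      @dense_in (compact_conv R T) (@sos_poly R T) (@nonneg_poly R T)
    & @dense_in (co_topology R T) (@sos_poly R T) (@nonneg_poly R T)].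
Proof.
(* Limits of sequences suffice: in each topology the sequence is q + r / (n + 1). *)
have closureP (X : topologicalType) (A : set X) (u : nat -> X) (x : X) :
    (forall n, A (u n)) -> u @ \oo --> x -> closure A x.
  move=> Au; apply: (@closed_cvg _ _ _ _ u (closure A)).
    exact: closed_closure.
  by apply: nearW => n; exact: subset_closure.
have approx q (r : CPoly R T) :
    (forall e : R, 0 < e -> sos_poly (q + e%:C *: r)) ->
    forall n, sos_poly (q + (n.+1%:R^-1)%:C *: r).
  by move=> qr n; apply: qr; rewrite invr_gt0.
split; (split; first exact: sos_poly_nonneg) => q
  /(nonneg_poly_approx Tdiag)[r /approx qr].
- apply: (closureP (finest_lc (CPoly R T)) _ _ q qr).
  exact: cvg_seminorm_topology.
- apply: (closureP (compact_conv R T) _ _ q qr).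
  exact: cvg_compact_conv.
- apply: (closureP (co_topology R T) _ _ q qr).
  by apply: cvg_seminorm_topology => _ ->; exact: seminorm_co_norm.
Qed.
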